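(* There exists a ladder system $\mathcal L^\star$ such that $K_{\mathcal L^\star}$ is a Mrówka space with a continuous join semilattice operation.
   Context: If $L\subseteq\omega_1$ is a stationary set, a ladder system over $L$ is a family $\{c_\alpha:\alpha\in L,\ \alpha\text{ a limit ordinal}\}$ where each $c_\alpha$ is (the range of) a strictly increasing $\omega$-sequence cofinal in $\alpha$. It is an almost disjoint family on $\omega_1$, i.e. a family of infinite subsets any two distinct members of which have finite intersection. For an infinite almost disjoint family $\mathcal A$ on a set $S$ (here $S=\omega_1$), $K_{\mathcal A}=S\cup\mathcal A\cup\{\infty\}$ is the one-point compactification (with point $\infty$) of the locally compact space $S\cup\mathcal A$ in which points of $S$ are isolated and basic neighborhoods of $A\in\mathcal A$ are $\{A\}\cup(A\setminus F)$, $F\subseteq A$ finite. A Mrówka space is a compact scattered space of Cantor–Bendixson height 2 whose second Cantor–Bendixson derivative is a singleton. A join semilattice operation is an associative, commutative, idempotent binary operation. *)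

(* Defs.v *)
From HB Require Import structures.
From mathcomp Require Import all_boot all_order.
From mathcomp Require Import all_classical topology.
From mathcomp Require wochoice.

Set Implicit Arguments.
Unset Strict Implicit.
Unset Printing Implicit Defensive.

Import Order.TTheory.
Local Open Scope classical_set_scope.

Definition wo_rel : rel (set nat) :=
  sval (wochoice.well_ordering_principle (set nat)).

(* Some well-order of the uncountable type [set nat] is fixed; omega_1 is the
   set of those elements that have only countably many predecessors, i.e. the
   least uncountable initial segment of this well-order. *)
Definition omega1 : Type :=
  {x : set nat | `[< countable [set y | wo_rel y x] >]}.

HB.instance Definition _ := Choice.on omega1.

Definition omega1_le : rel omega1 := relpre sval wo_rel.

Lemma wo_relP (A : set (set nat)) : A !=set0 ->
  exists2 z, A z & forall x, A x -> wo_rel z x.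
Proof.
move=> [a Aa].
have wo := svalP (wochoice.well_ordering_principle (set nat)).
have [|z [[/asboolP Az zmin] _]] := wo (fun x => `[< A x >]).
  by exists a; apply/asboolP.
by exists z => // x Ax; apply: zmin; apply/asboolP.
Qed.

Lemma wo_rel_anti : antisymmetric wo_rel.
Proof.
move=> x y /andP[xy yx].
have wo := svalP (wochoice.well_ordering_principle (set nat)).
have wox z : wo_rel z z.
  by have [|_ -> /(_ z erefl)] := @wo_relP [set z]; first by exists z.
have [|z [_ zU]] := wo (pred2 x y); first by exists x; rewrite inE eqxx.
rewrite -(zU x) ?(zU y) //; split; rewrite ?inE ?eqxx ?orbT // => t;
  by rewrite inE => /orP[] /eqP ->; rewrite -/wo_rel ?wox.
Qed.

Lemma wo_rel_total : total wo_rel.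
Proof.
move=> x y; have [|z [] -> zmin] := @wo_relP [set x; y]; first by exists x; left.
  by rewrite zmin //; right.
by rewrite orbC zmin //; left.
Qed.

Lemma wo_rel_trans : transitive wo_rel.
Proof.
move=> y x z xy yz.
have [|m [[]|] -> mmin] := @wo_relP [set x; y; z]; first by exists x; left; left.
- by apply: mmin; right.
- have yx : wo_rel y x by apply: mmin; left; left.
  by rewrite (@wo_rel_anti x y) // xy yx.
- have zy : wo_rel z y by apply: mmin; left; right.
  by rewrite -(@wo_rel_anti y z) // yz zy.
Qed.

Lemma sval_omega1_inj : injective (sval : omega1 -> set nat).
Proof. exact: (@val_inj _ _ {x | `[< countable [set y | wo_rel y x] >]}). Qed.

Lemma omega1_le_anti : antisymmetric omega1_le.
Proof. by move=> x y /wo_rel_anti/sval_omega1_inj. Qed.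

Lemma omega1_le_trans : transitive omega1_le.
Proof. by move=> y x z; apply: wo_rel_trans. Qed.

Lemma omega1_le_total : total omega1_le.
Proof. by move=> x y; apply: wo_rel_total. Qed.

Fact omega1_display : Order.disp_t. Proof. exact: Order.Disp tt tt. Qed.

HB.instance Definition _ := @Order.isOrder.Build omega1_display omega1
  omega1_le _ _ _ (fun _ _ => erefl) (fun _ _ => erefl) (fun _ _ => erefl)
  omega1_le_anti omega1_le_trans omega1_le_total.

Lemma omega1_well_founded (A : set omega1) : A !=set0 ->
  exists2 z, A z & forall x, A x -> (z <= x)%O.
Proof.
move=> [a Aa].
have [|_ [z Az <-] zmin] := @wo_relP ((sval : omega1 -> _) @` A).
  by exists (sval a), a.
by exists z => // x Ax; apply: zmin; exists x.
Qed.

Lemma omega1_countable_below (x : omega1) :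
  countable [set y : omega1 | (y < x)%O].
Proof.
have /asboolP/countable_injP[f finj] := svalP x.
apply/countable_injP; exists (f \o sval) => y z.
rewrite !inE => yx zx fyz; apply: sval_omega1_inj.
by apply: finj => //; rewrite inE; [exact: (ltW yx)|exact: (ltW zx)].
Qed.

Lemma omega1_uncountable : ~ countable [set: omega1].
Proof.
move=> c1; pose A := [set x | countable [set y | wo_rel y x]].
have cA : countable A.
  have -> : A = (sval : omega1 -> _) @` setT.
    apply/seteqP; split=> [x Ax|_ [x _ <-]]; last by have /asboolP := svalP x.
    have Px : `[< countable [set y | wo_rel y x] >] by apply/asboolP.
    by exists (exist _ x Px).
  exact: sub_countable (card_image_le _ _) c1.
have AT x : A x.
  apply: contrapT => nAx.
  have [|z nAz zmin] := @wo_relP (~` A); first by exists x.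
  apply: nAz; rewrite /A /=.
  have sub : [set y | wo_rel y z] `<=` \bigcup_(b in [set: bool])
      (if b then A else [set z]).
    move=> y /= yz; have [Ay|nAy] := pselect (A y); first by exists true.
    by exists false => //=; apply: wo_rel_anti; rewrite yz zmin.
  apply: sub_countable (subset_card_le sub) _.
  by apply: bigcup_countable => [|[] _]; [exact: countableP| |exact: countable1].
have /countable_injP[f finj] := cA.
have {}finj X Y : f X = f Y -> X = Y by apply: finj; rewrite inE; exact: AT.
pose D := [set n | exists2 X, f X = n & ~ X n].
have [DD|nDD] := pselect (D (f D)).
  by have [X /finj XD] := DD; rewrite XD.
by apply: (nDD); exists D.
Qed.

Section ladders.
Context {d : Order.disp_t} {T : orderType d}.
Implicit Types (a b : T) (C L : set T).

Definition is_limit a :=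
  (exists b, (b < a)%O) /\ forall b, (b < a)%O -> exists c, (b < c < a)%O.

Definition unbounded_in a C :=
  forall b, (b < a)%O -> exists2 c, C c & (b < c < a)%O.

Definition club C :=
  (forall b, exists2 c, C c & (b < c)%O) /\
  (forall a, is_limit a -> unbounded_in a C -> C a).

Definition stationary L := forall C, club C -> L `&` C !=set0.

Definition ladder_at a C := exists f : nat -> T,
  [/\ {homo f : m n / (m < n)%N >-> (m < n)%O},
      forall n, (f n < a)%O,
      forall b, (b < a)%O -> exists n, (b < f n)%O &
      C = range f].

Definition ladder_system L (c : T -> set T) :=
  stationary L /\ forall a, L a -> is_limit a -> ladder_at a (c a).

Definition ladder_family L (c : T -> set T) : set (set T) :=
  c @` (L `&` is_limit).

End ladders.

Section psi_space.
Context {S : choiceType}.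

(* The members of [A] are added to [S] as points through the coercion of
   [A : set (set S)] to the type of its elements. *)
Definition psi_space (A : set (set S)) : Type := (S + A)%type.

Variable A : set (set S).

HB.instance Definition _ := Choice.on (psi_space A).

Definition psi_nbhs (p : psi_space A) : set_system (psi_space A) :=
  match p with
  | inl s => principal_filter (inl s)
  | inr B => filter_from finite_set
      (fun F => [set inr B] `|` inl @` (set_val B `\` F))
  end.

Let psi_filter (p : psi_space A) : ProperFilter (psi_nbhs p).
Proof.
case: p => [s|B]; first exact: principal_filter_proper.
apply: filter_from_proper; last by move=> F _; exists (inr B); left.
apply: filter_from_filter; first by exists set0.
move=> F G finF finG; exists (F `|` G); first by rewrite finite_setU.
move=> _ [->|[x [Bx /not_orP[nFx nGx]] <-]]; first by split; left.
by split; right; exists x.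
Qed.

Let psi_singleton (p : psi_space A) (U : set (psi_space A)) :
  psi_nbhs p U -> U p.
Proof. by case: p => [s /principal_filterP//|B [F _]]; apply; left. Qed.

Let psi_nbhs_nbhs (p : psi_space A) (U : set (psi_space A)) :
  psi_nbhs p U -> psi_nbhs p (psi_nbhs^~ U).
Proof.
case: p => [s|B].
  by move=> /principal_filterP Us; do 2 apply/principal_filterP.
case=> F finF FU; exists F => // _ [->|[x Bx <-]]; first by exists F.
by apply/principal_filterP; apply: FU; right; exists x.
Qed.

HB.instance Definition _ := hasNbhs.Build (psi_space A) psi_nbhs.

HB.instance Definition _ := @Nbhs_isNbhsTopological.Build (psi_space A)
  psi_filter psi_singleton psi_nbhs_nbhs.

End psi_space.

Definition K_space (S : choiceType) (A : set (set S)) : topologicalType :=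
  one_point_compactification (psi_space A).

Section mrowka.
Variable X : topologicalType.

Definition scattered := forall A : set X, A !=set0 -> isolated A !=set0.

Definition cb_derivative (n : nat) : set X :=
  iter n (fun A => A `\` isolated A) setT.

(* The height is the last level whose derivative is nonempty. *)
Definition has_cb_height (n : nat) :=
  cb_derivative n !=set0 /\ cb_derivative n.+1 = set0.

(* "Compact space" includes the Hausdorff axiom. *)
Definition mrowka_space :=
  [/\ compact [set: X], hausdorff_space X, scattered, has_cb_height 2 &
      exists x, cb_derivative 2 = [set x]].

Definition join_semilattice_op (op : X -> X -> X) :=
  [/\ associative op, commutative op & idempotent_op op].

End mrowka.

(* Main.v *)
Require Import Defs.
From mathcomp Require Import all_boot all_order.
From mathcomp Require Import all_classical topology.

(** The idea is to draw the ladders as branches of a tree.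

    Suppose that [omega1] carries a tree order in which every point has finitely
    many predecessors, and that every ladder is a branch, that is, a chain
    closed under predecessors.  Extend the order to the compact space [K] of the
    ladders: put a ladder [B] above its own elements, and infinity above
    everything.  The elements below a point other than infinity form a chain, so
    any two elements have a join: the larger one if they are comparable,
    infinity otherwise ([forest_joinA], [forest_joinC], [forest_joinxx]).  The
    set of elements below a point [x] other than infinity is finite if [x] is in
    [omega1] and is [B] together with its own point if [x = B]; as the ladders
    are almost disjoint, it is clopen.  Cutting neighbourhoods along these
    clopen chains shows that the join is continuous ([forest_join_continuous]).

    It remains to find the tree and the ladders.  Every ordinal is [l + n] with
    [l] zero or a limit; for each limit [l] an injection [e l] of the ordinals
    below [l] into the natural numbers lets [l + e l g] be a child of [g].  So
    every [g] gets a child just above each limit beyond [g] ([exists_parent]).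
     Parents are smaller than their children, so every point has only finitely
    many predecessors ([ancestor_tree]).  If [a] is a limit of limits, each [g]
    below [a] has children cofinally in [a]; climbing from child to child
    through a countable cofinal set of [a] gives a branch cofinal in [a]
    ([exists_branch]).  The limits of limits are stationary
    ([stationary_limit_of_limits]).

    That [K] is a Mrowka space holds for every infinite almost disjoint family
    ([K_space_mrowka]). *)

Set Implicit Arguments.
Unset Strict Implicit.
Unset Printing Implicit Defensive.

Import Order.TTheory.
Local Open Scope classical_set_scope.

(** * Joins in a forest with a top *)

Record forest_with_top (T : Type) (le : T -> T -> Prop) (top : T) : Prop := {
  forest_refl : forall x, le x x;
  forest_trans : forall y x z, le x y -> le y z -> le x z;
  forest_anti : forall x y, le x y -> le y x -> x = y;
  forest_top : forall x, le x top;
  forest_chain : forall z, z <> top ->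
    forall x y, le x z -> le y z -> le x y \/ le y x }.

Definition forest_join (T : Type) (le : T -> T -> Prop) (top x y : T) : T :=
  if `[< le x y >] then y else if `[< le y x >] then x else top.

Section forest_join.
Variables (T : Type) (le : T -> T -> Prop) (top : T).
Hypothesis F : forest_with_top le top.
Local Notation join := (forest_join le top).

(** The join is a least upper bound: two incomparable elements have only the top
    above them, since the elements below any other point form a chain.  The
    semilattice laws follow from this by antisymmetry. *)
Lemma forest_joinP z x y : le (join x y) z <-> le x z /\ le y z.
Proof.
have [rf tr ant lt ch] := F; rewrite /forest_join.
case: asboolP => [xy|nxy]; first by split=> [yz|[]//]; split=> //; exact: tr yz.
case: asboolP => [yx|nyx]; first by split=> [xz|[]//]; split=> //; exact: tr xz.
split=> [tz|[xz yz]]; first by split; exact: tr tz.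
have [->//|ztop] := pselect (z = top).
by have [] := ch z ztop x y xz yz.
Qed.

Lemma forest_joinC : commutative join.
Proof.
have ant := forest_anti F; have rf := forest_refl F.
have le_join x y : le (join x y) (join y x).
  by have /forest_joinP[yj xj] := rf (join y x); apply/forest_joinP.
by move=> x y; apply: ant.
Qed.

Lemma forest_joinA : associative join.
Proof.
have ant := forest_anti F; have rf := forest_refl F.
move=> x y z; apply: ant.
  have /forest_joinP[/forest_joinP[xj yj] zj] := rf (join (join x y) z).
  by apply/forest_joinP; split=> //; apply/forest_joinP.
have /forest_joinP[xj /forest_joinP[yj zj]] := rf (join x (join y z)).
by apply/forest_joinP; split=> //; apply/forest_joinP.
Qed.

Lemma forest_joinxx : idempotent_op join.
Proof.
by move=> x; rewrite /forest_join asboolT //; exact: forest_refl F _.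
Qed.

End forest_join.

(** At [(x, y)] with [x] strictly below [y], a point near [x] is below [x], and
    a point near [y] is not; so the join of the two is the second one or, only
    when [y] is the top, possibly the top.  At incomparable [x] and [y], points
    near them are incomparable too.  On the diagonal, away from the top, the
    chain below [x] is a neighbourhood on which the join only takes one of its
    two arguments. *)
Lemma forest_join_continuous (X : topologicalType) (le : X -> X -> Prop)
    (top : X) :
  forest_with_top le top ->
  (forall x, x <> top -> clopen [set y | le y x]) ->
  continuous (fun p : X * X => forest_join le top p.1 p.2).
Proof.
move=> F clop; have [rf tr ant lt ch] := F.
pose D x := [set y | le y x].
have nbhsD x : x <> top -> nbhs x (D x).
  by move=> /clop[oD _]; apply: open_nbhs_nbhs; split=> //; exact: rf.
have nbhsDC x y : x <> top -> ~ le y x -> nbhs y (~` D x).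
  move=> /clop[_ cD] nyx; apply: open_nbhs_nbhs.
  by split=> //; exact: closed_openC.
have below x y U : x <> y -> le x y -> nbhs y U ->
    exists2 VW : set X * set X, nbhs x VW.1 /\ nbhs y VW.2 &
      forall v w, VW.1 v -> VW.2 w -> U (forest_join le top v w).
  move=> xy lexy Uy.
  have xtop : x <> top by move=> xt; apply: xy; apply: ant => //; rewrite xt.
  have nyx : ~ le y x by move=> yx; apply: xy; exact: ant.
  (* When [y] is the top there is no chain below it: [v] and [w] may be
     incomparable, but their join is then the top, which is in [U]. *)
  have [ytop|ytop] := pselect (y = top).
    exists (D x, U `&` ~` D x).
      by split=> /=; [exact: nbhsD|apply: filterI => //; exact: nbhsDC].
    move=> v w /= vx [Uw nwx]; rewrite /forest_join.
    case: asboolP => // _; case: asboolP => [wv|_].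
      by case: nwx; exact: tr vx.
    by rewrite -ytop; exact: nbhs_singleton.
  exists (D x, U `&` D y `&` ~` D x).
    split=> /=; first exact: nbhsD.
    by apply: filterI; [apply: filterI => //; exact: nbhsD|exact: nbhsDC].
  move=> v w /= vx [[Uw wy] nwx]; rewrite /forest_join.
  have vw : le v w.
    have [//|wv] := ch y ytop v w (tr _ _ _ vx lexy) wy.
    by case: nwx; exact: tr vx.
  by case: asboolP.
move=> [x y] /= U Ujoin.
suff [[V W] /= [xV yW] VWU] : exists2 VW : set X * set X,
    nbhs x VW.1 /\ nbhs y VW.2 &
    forall v w, VW.1 v -> VW.2 w -> U (forest_join le top v w).
  by exists (V, W) => // -[v w] [/= Vv Ww]; exact: VWU.
have [xy|xy] := pselect (x = y).
  rewrite -xy (forest_joinxx F) in Ujoin *.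
  have [xtop|xtop] := pselect (x = top).
    exists (U, U) => //= v w Uv Uw; rewrite /forest_join.
    by do 2!case: asboolP => // _; rewrite -xtop; exact: nbhs_singleton.
  exists (U `&` D x, U `&` D x) => /=.
    by split; apply: filterI => //; exact: nbhsD.
  move=> v w [Uv vx] [Uw wx]; rewrite /forest_join.
  case: asboolP => // vw; case: asboolP => // wv.
  by case: (ch x xtop v w vx wx).
have [lexy|nlexy] := pselect (le x y).
  by apply: below => //; move: Ujoin; rewrite /forest_join asboolT.
have [leyx|nleyx] := pselect (le y x).
  have [|[V W] /= [yV xW] VWU] := below y x U (nesym xy) leyx.
    by move: Ujoin; rewrite /forest_join asboolF // asboolT.
  by exists (W, V) => //= v w Wv Vw; rewrite (forest_joinC F); exact: VWU.
have xtop : x <> top by move=> xt; apply: nleyx; rewrite xt.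
have ytop : y <> top by move=> yt; apply: nlexy; rewrite yt.
exists (D x `&` ~` D y, D y `&` ~` D x) => /=.
  by split; apply: filterI; [exact: nbhsD|exact: nbhsDC
                            |exact: nbhsD|exact: nbhsDC].
move=> v w [vx nvy] [wy nwx]; rewrite /forest_join.
case: asboolP => [vw|_]; first by case: nvy; exact: tr wy.
case: asboolP => [wv|_]; first by case: nwx; exact: tr vx.
move: Ujoin; rewrite /forest_join !asboolF //; exact: nbhs_singleton.
Qed.

(** * The Mrowka space of an almost disjoint family *)

Definition almost_disjoint (S : Type) (A : set (set S)) :=
  (forall B, A B -> infinite_set B) /\
  (forall B C, A B -> A C -> B <> C -> finite_set (B `&` C)).

Section psi_space.
Context {S : choiceType} (A : set (set S)).
Local Notation Psi := (psi_space A).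
Local Notation K := (K_space A).

(** The basic compact open neighbourhood of a point. *)
Definition star (x : Psi) : set Psi :=
  match x with
  | inl s => [set inl s]
  | inr B => [set inr B] `|` inl @` set_val B
  end.

Lemma nbhs_psi_inl (s : S) (U : set Psi) : nbhs (inl s : Psi) U <-> U (inl s).
Proof. exact: principal_filterP. Qed.

Lemma star_refl x : star x x.
Proof. by case: x => [s|B] //=; left. Qed.

Lemma star_open x : open (star x).
Proof.
rewrite openE => -[s|B] xs; first exact/nbhs_psi_inl.
exists set0 => // y; rewrite setD0; case: x xs => [//|C] /= [[->]|[]//].
by [].
Qed.

Lemma star_inr x (B : A) : star x (inr B) -> x = inr B.
Proof. by case: x => [s|C] //= [[->]|[]]. Qed.

(** A filter on the star of [B] that does not cluster at [B] lives on finitely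
    many isolated points. *)
Lemma star_compact x : compact (star x).
Proof.
case: x => [s|B]; first exact: compact_set1.
move=> F FF FB; have [cB|nB] := pselect (cluster F (inr B)).
  by exists (inr B); split=> //; exact: star_refl.
have [V FV [G finG GV]] : exists2 V, F V & exists2 G, finite_set G &
    V `&` ([set inr B] `|` inl @` (set_val B `\` G)) = set0.
  apply: contra_notP nB => nV V W FV [G finG GW].
  apply/set0P/negP => /eqP VW0; apply: nV; exists V => //; exists G => //.
  by apply/seteqP; split=> // y [Vy /GW Wy]; rewrite -VW0.
have finP : finite_set ((inl : S -> Psi) @` (set_val B `&` G)).
  exact/finite_image/finite_setIr.
have [|y [[s [Bs Gs] <-] cs]] := finite_compact finP FF.
  apply: filterS (filterI FV FB) => y [Vy [yB|[s Bs sy]]].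
    by suff : set0 y by []; rewrite -GV; split=> //; left.
  exists s => //; split=> //; apply: contrapT => nGs.
  by suff : set0 y by []; rewrite -GV; split=> //; right; exists s.
by exists (inl s); split=> //; right; exists s.
Qed.

Hypothesis adA : almost_disjoint A.

(** This is where almost disjointness enters: a member [C] other than [B] has a
    neighbourhood missing the finite set of points that it shares with [B]. *)
Lemma star_closed x : closed (star x).
Proof.
rewrite -[star x]setCK; apply: open_closedC; rewrite openE => -[s|C] xs.
  exact/nbhs_psi_inl.
case: x xs => [s _|B /= xs].
  by exists [set s] => // y [->//|[t [_ ts] <-] [st]]; exact: ts.
exists (set_val B `&` set_val C).
  apply: adA.2; [exact: set_valP|exact: set_valP|].
  by move=> /val_inj BC; apply: xs; left; rewrite BC.
move=> y [->//|[t [Ct nBt] <-]] [//|[u Bu [ut]]].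
by apply: nBt; split=> //; rewrite -ut.
Qed.

Lemma star_separates x y : x <> y -> ~ star x y \/ ~ star y x.
Proof.
case: x y => [s|B] [t|C] xy /=; [by left; apply: nesym|by left| |].
  by right.
by left => -[/esym//|[]].
Qed.

Lemma psi_space_hausdorff : hausdorff_space Psi.
Proof.
move=> x y cxy; apply: contrapT => xy.
have sep u v : ~ star u v -> exists2 UV : set Psi * set Psi,
    nbhs u UV.1 /\ nbhs v UV.2 & UV.1 `&` UV.2 = set0.
  move=> nuv; exists (star u, ~` star u); last exact: setICr.
  split; apply: open_nbhs_nbhs; split=> //=.
  - exact: star_open.
  - exact: star_refl.
  - exact/closed_openC/star_closed.
have [/sep|/sep] := star_separates xy => -[[U V] /= [Uu Vv] UV0].
- by have := cxy U V Uu Vv; rewrite UV0 => -[].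
- by have := cxy V U Vv Uu; rewrite setIC UV0 => -[].
Qed.

Lemma psi_space_locally_compact : locally_compact [set: Psi].
Proof.
move=> x _; exists (star x); last first.
  by split; [exact: star_compact|exact: star_closed].
by rewrite withinET; apply: open_nbhs_nbhs; split;
  [exact: star_open|exact: star_refl].
Qed.

Lemma K_space_hausdorff : hausdorff_space K.
Proof.
apply: one_point_compactification_hausdorff.
- exact: psi_space_locally_compact.
- exact: psi_space_hausdorff.
Qed.

Lemma some_clopen (U : set Psi) : open U -> compact U -> @clopen K (Some @` U).
Proof.
move=> oU cU; split; first exact: one_point_compactification_open_some.
apply: compact_closed; first exact: K_space_hausdorff.
apply: continuous_compact => //; apply: continuous_subspaceT.
exact: one_point_compactification_some_continuous.
Qed.

Definition non_isolated_points : set K :=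
  [set x | if x is Some (inl _) then False else True].

Lemma isolated_inl (D : set K) (s : S) :
  D (Some (inl s)) -> isolated D (Some (inl s)).
Proof.
move=> Ds; split; first exact/mem_set.
exists [set Some (inl s : Psi)]; first by apply/nbhs_psi_inl.
by apply/seteqP; split=> [x []|x ->].
Qed.

Lemma isolated_inr (D : set K) (B : A) :
  D `<=` non_isolated_points -> D (Some (inr B)) -> isolated D (Some (inr B)).
Proof.
move=> DN DB; split; first exact/mem_set.
exists (Some @` star (inr B : Psi)).
  apply: one_point_compactification_some_nbhs; apply: open_nbhs_nbhs.
  by split; [exact: star_open|exact: star_refl].
apply/seteqP; split=> [x [[_ [->|[s _ <-]] <-]] //|x ->]; first by move=> /DN.
by split=> //; exists (inr B) => //; left.
Qed.

Lemma inr_not_isolated (B : A) : ~ isolated [set: K] (Some (inr B)).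
Proof.
move=> [_ [V [F finF FV] VB]].
have [s [Bs nFs]] := infinite_setN0 (infinite_setD (adA.1 _ (set_valP B)) finF).
have : ([set Some (inr B)] : set K) (Some (inl s)).
  by rewrite -VB; split=> //; apply: FV; right; exists s.
by [].
Qed.

(** If infinity were isolated in [D], a neighbourhood of it and the stars would
    cover the compact space [K]; each star contains at most one member of [A] as
    a point, so a finite subcover would leave only finitely many of them. *)
Lemma infinity_not_isolated (D : set K) :
  infinite_set A -> (forall B : A, D (Some (inr B))) -> ~ isolated D None.
Proof.
move=> infA DB [_ [V]]; rewrite nbhsE => -[U [oU UN] UV] VD.
pose f (x : K) : set K := if x is Some y then Some @` star y else U.
have cK : @cover_compact K setT.
  by rewrite -compact_cover; exact: one_point_compactification_compact.
have [||I _ If] := cK K setT f.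
- move=> [x|] _ //=; apply: one_point_compactification_open_some.
  exact: star_open.
- move=> [x|] _; last by exists None.
  by exists (Some x) => //; exists x => //; exact: star_refl.
apply: infA.
pose g (x : K) : set S := if x is Some (inr B) then set_val B else set0.
apply: sub_finite_set (finite_image g (finite_fset I)) => B AB.
pose b : A := SigSub (mem_set AB).
have [i iI fi] := If (Some (inr b)) Logic.I.
exists i => //; case: i iI fi => [x _ [y xy [yb]]|_ Ub].
  by rewrite yb in xy; rewrite (star_inr xy).
have : ([set None] : set K) (Some (inr b)).
  by rewrite -VD; split=> //; exact: UV.
by [].
Qed.

Lemma cb_derivative1 :
  infinite_set A -> @cb_derivative K 1 = non_isolated_points.
Proof.
move=> infA; apply/seteqP; split=> [[[s|B]|]//= [_ nis]|[[s|B]|]//= _].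
- by apply: nis; exact: isolated_inl.
- by split=> //; exact: inr_not_isolated.
- by split=> //; exact: infinity_not_isolated.
Qed.

Lemma cb_derivative2 : infinite_set A -> @cb_derivative K 2 = [set None].
Proof.
move=> infA.
rewrite /cb_derivative iterS -/(@cb_derivative K 1) cb_derivative1 //.
apply/seteqP; split=> [[[s|B]|] [N nis]|_ ->] //.
- by case: nis; exact: isolated_inr.
- by split=> //; exact: infinity_not_isolated.
Qed.

Lemma isolated_set1 (x : K) : isolated [set x] x.
Proof.
by split; [rewrite inE|exists setT; [exact: filterT|rewrite setTI]].
Qed.

Lemma K_space_mrowka : infinite_set A -> mrowka_space K.
Proof.
move=> infA; split.
- exact: one_point_compactification_compact.
- exact: K_space_hausdorff.
- move=> D [d Dd].
  have [[s Ds]|nDl] := pselect (exists s, D (Some (inl s))).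
    by exists (Some (inl s)); exact: isolated_inl.
  have DN : D `<=` non_isolated_points.
    by move=> [[s|B]|] //= Ds; apply: nDl; exists s.
  have [[B DB]|nDr] := pselect (exists B, D (Some (inr B))).
    by exists (Some (inr B)); exact: isolated_inr.
  suff -> : D = [set None] by exists None; exact: isolated_set1.
  have D0 x : D x -> x = None.
    by case: x => [[s|B]|] // Dx; [case: nDl; exists s|case: nDr; exists B].
  by apply/seteqP; split=> [x /D0//|_ ->]; rewrite -(D0 d Dd).
- split; first by rewrite cb_derivative2 //; exists None.
  rewrite /cb_derivative iterS -/(@cb_derivative K 2) cb_derivative2 //.
  rewrite -subset0 => _ [-> []]; exact: isolated_set1.
- by exists None; exact: cb_derivative2.
Qed.

End psi_space.

(** * The semilattice of a tree with branches *)

Section tree.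
Context {S : choiceType} (tle : S -> S -> Prop).

Record finitary_tree : Prop := {
  tree_refl : forall s, tle s s;
  tree_trans : forall t s u, tle s t -> tle t u -> tle s u;
  tree_anti : forall s t, tle s t -> tle t s -> s = t;
  tree_chain : forall u s t, tle s u -> tle t u -> tle s t \/ tle t s;
  tree_finite : forall s, finite_set [set t | tle t s] }.

Definition initial_chain (B : set S) :=
  (forall s t, B t -> tle s t -> B s) /\
  (forall s t, B s -> B t -> tle s t \/ tle t s).

Variable A : set (set S).

Definition psi_le (x y : psi_space A) : Prop :=
  match x, y with
  | inl s, inl t => tle s t
  | inl s, inr B => set_val B s
  | inr B, inr C => B = C
  | inr _, inl _ => False
  end.

Definition K_le (x y : K_space A) : Prop :=
  if y is Some y' then if x is Some x' then psi_le x' y' else False else True.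

Hypotheses (treeS : finitary_tree) (adA : almost_disjoint A).
Hypothesis chainA : forall B, A B -> initial_chain B.

(** Initiality of the branches is transitivity through a member of [A]; that
    they are chains is the chain condition below a member of [A]. *)
Lemma K_le_forest : forest_with_top K_le None.
Proof.
have [rf tr ant ch _] := treeS.
have down (B : A) := (chainA (set_valP B)).1.
have chB (B : A) := (chainA (set_valP B)).2.
split.
- by move=> [[s|B]|] //=.
- move=> [[s|B]|] [[t|C]|] [[u|D]|] //=.
  + exact: tr.
  + by move=> ts Ds; exact: down ts.
  + by move=> Bt <-.
  + by move=> ->.
- move=> [[s|B]|] [[t|C]|] //=.
  + by move=> st ts; rewrite (ant s t).
  + by move=> ->.
- by case.
- move=> [[u|D]|] // _ [[s|B]|] [[t|C]|] //=.
  + exact: ch.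
  + exact: chB.
  + by move=> Ds ->; left.
  + by move=> -> Dt; right.
  + by move=> -> ->; left.
Qed.

(** The set below a member of [A] is its star; the set below a point of [S] is a
    finite set of isolated points. *)
Lemma K_le_clopen x : x <> None -> clopen [set y | K_le y x].
Proof.
case: x => [x _|//].
have -> : [set y | K_le y (Some x)] = Some @` [set y | psi_le y x].
  by apply/seteqP; split=> [[y yx|//]|_ [y yx <-]//]; exists y.
case: x => [s|B]; last first.
  have -> : [set y : psi_space A | psi_le y (inr B)] = star (inr B).
    apply/seteqP; split=> [[t Bt|C ->]|_ [->|[t Bt <-]]]//=; last by left.
    by right; exists t.
  by apply: some_clopen => //; [exact: star_open|exact: star_compact].
apply: some_clopen => //.
  rewrite openE => -[t ts|//]; exact/nbhs_psi_inl.
apply: finite_compact.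
apply: sub_finite_set (finite_image inl (tree_finite treeS s)) => -[t ts|//].
by exists t.
Qed.

Lemma K_space_semilattice : exists op : K_space A -> K_space A -> K_space A,
  join_semilattice_op op /\
  continuous (fun p : K_space A * K_space A => op p.1 p.2).
Proof.
exists (forest_join K_le None); split; last first.
  by apply: forest_join_continuous; [exact: K_le_forest|exact: K_le_clopen].
split.
- exact: forest_joinA K_le_forest.
- exact: forest_joinC K_le_forest.
- exact: forest_joinxx K_le_forest.
Qed.

End tree.

(** * Ladders *)

Section ladder.
Context {d : Order.disp_t} {T : orderType d}.
Local Open Scope order_scope.
Local Open Scope classical_set_scope.
Implicit Types (a b : T) (C : set T).

Lemma ladder_infinite a C : ladder_at a C -> infinite_set C.
Proof.
move=> [f [fmono _ _ ->]].
rewrite (eq_finite_set (inj_card_eq _)); first exact: infinite_nat.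
move=> m n _ _ fmn.
by case: (ltngtP m n) => // /fmono; rewrite fmn ltxx.
Qed.

(** Cofinality bounds the number of terms below [b]; almost disjointness of
    ladders at different points follows, as one of them stays below the other
    point. *)
Lemma ladder_finite_below a b C :
  ladder_at a C -> b < a -> finite_set (C `&` [set x | x < b]).
Proof.
move=> [f [fmono _ fcof ->]] /fcof[N bN].
apply: sub_finite_set (finite_image f (finite_II N)) => _ [[n _ <-] /= nb].
exists n => //=; rewrite ltnNge; apply/negP.
rewrite leq_eqVlt => /orP[/eqP Nn|].
  by move: bN; rewrite Nn ltNge (ltW nb).
by move=> /fmono Nn; move: (lt_trans bN (lt_trans Nn nb)); rewrite ltxx.
Qed.

Lemma ladder_almost_disjoint a b C D :
  ladder_at a C -> ladder_at b D -> a != b -> finite_set (C `&` D).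
Proof.
have below a' b' C' D' : ladder_at a' C' -> ladder_at b' D' -> a' < b' ->
    finite_set (C' `&` D').
  move=> [f [_ fa _ ->]] lD ab.
  apply: sub_finite_set (ladder_finite_below lD ab) => _ [[n _ <-] Dn].
  by split=> //=; exact: fa.
move=> lC lD; rewrite neq_lt => /orP[|]; first exact: below.
by rewrite setIC; exact: below.
Qed.

Lemma ladder_inj a b C : ladder_at a C -> ladder_at b C -> a = b.
Proof.
move=> lC lC'; apply/eqP/negPn/negP => ab.
apply: (ladder_infinite lC); rewrite -[C]setIid.
exact: ladder_almost_disjoint ab.
Qed.

Lemma ladder_family_almost_disjoint L (c : T -> set T) :
  ladder_system L c -> almost_disjoint (ladder_family L c).
Proof.
move=> [_ lc]; split=> [_ [a [La la] <-]|_ _ [a [La la] <-] [b [Lb lb] <-] cab].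
  exact: ladder_infinite (lc a La la).
apply: ladder_almost_disjoint (lc a La la) (lc b Lb lb) _.
by apply/eqP => ab; apply: cab; rewrite ab.
Qed.

Lemma ladder_family_infinite L (c : T -> set T) :
  ladder_system L c -> infinite_set (L `&` is_limit) ->
  infinite_set (ladder_family L c).
Proof.
move=> [_ lc]; rewrite /ladder_family (eq_finite_set (inj_card_eq _)) //.
move=> a b /set_mem[La la] /set_mem[Lb lb] cab.
by apply: (ladder_inj (lc a La la)); rewrite cab; exact: lc.
Qed.

End ladder.

(** * The tree of a regressive function *)

Section ancestor.
Context {d : Order.disp_t} {T : orderType d}.
Local Open Scope order_scope.
Local Open Scope classical_set_scope.
Variable p : T -> T.

Definition ancestor (x y : T) := exists n, x = iter n p y.

Hypothesis p_le : forall x, p x <= x.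
Hypothesis wf : forall D : set T, D !=set0 ->
  exists2 z, D z & forall x, D x -> z <= x.

Lemma iter_parent_le n x : iter n p x <= x.
Proof. by elim: n => //= n; exact: le_trans. Qed.

(** Iterating a regressive function strictly decreases until it reaches a fixed
    point, so well-foundedness makes the set of ancestors finite. *)
Lemma ancestor_tree : finitary_tree ancestor.
Proof.
split.
- by move=> x; exists 0.
- by move=> y x z [n ->] [m ->]; exists (n + m); rewrite iterD.
- move=> x y [n xy] [m yx]; apply/le_anti.
  by rewrite {1}xy iter_parent_le yx iter_parent_le.
- move=> z _ _ [n ->] [m ->]; have [nm|/ltnW mn] := leqP n m.
    by right; exists (m - n); rewrite -iterD subnK.
  by left; exists (n - m); rewrite -iterD subnK.
- move=> x; apply: contrapT => nfin.
  have [|z nz zmin] := @wf [set x | infinite_set [set t | ancestor t x]].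
    by exists x.
  apply: nz; have anc : [set t | ancestor t z] `<=`
      [set z] `|` [set t | ancestor t (p z)].
    by move=> _ [[|n] ->]; [left|right; exists n; rewrite iterSr].
  have [pz|pz] := eqVneq (p z) z.
    apply: sub_finite_set (finite_set1 z) => _ [n ->] /=.
    by elim: n => //= n ->.
  apply: sub_finite_set anc _; rewrite finite_setU; split => //.
  apply: contrapT => /zmin; rewrite leNgt lt_neqAle pz p_le //.
Qed.

Lemma branch_initial_chain (f : nat -> T) :
  p (f 0) = f 0 -> (forall n, p (f n.+1) = f n) ->
  initial_chain ancestor (range f).
Proof.
move=> f0 fS.
have down i n : ancestor (f n) (f (i + n)).
  by exists i; elim: i => // i IH; rewrite addSn iterSr fS.
split.
  move=> _ _ [n _ <-] [i ->]; elim: i => [|i [m _ im]] /=; first by exists n.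
  rewrite -im; case: m {im} => [|m]; first by rewrite f0; exists 0.
  by rewrite fS; exists m.
move=> _ _ [n _ <-] [m _ <-]; have [nm|/ltnW mn] := leqP n m.
  by left; rewrite -(subnK nm); exact: down.
by right; rewrite -(subnK mn); exact: down.
Qed.

End ancestor.

(** * Limit ordinals below omega_1 *)

Section omega1.
Local Open Scope order_scope.
Local Open Scope classical_set_scope.
Local Notation T := omega1.
Implicit Types (a b x y l : T) (P Q : set T).

Lemma omega1_countable_bounded P :
  countable P -> exists b, forall x, P x -> x < b.
Proof.
move=> cP; apply: contrapT => nb; apply: omega1_uncountable.
suff -> : [set: T] = \bigcup_(x in P) ([set y | y < x] `|` [set x]).
  apply: bigcup_countable => // x _.
  rewrite -bigcup2E; apply: bigcup_countable => // -[|[|i]] _ //=.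
  exact: omega1_countable_below.
apply/seteqP; split=> // b _; apply: contrapT => nbP.
apply: nb; exists b => x Px; rewrite ltNge; apply/negP.
rewrite le_eqVlt => /orP[/eqP bx|bx]; apply: nbP; exists x => //.
  by right.
by left.
Qed.

Lemma omega1_bottom : exists o, forall x : T, o <= x.
Proof.
have [|o _ omin] := @omega1_well_founded setT.
  by have [o _] := omega1_countable_bounded (@countable0 T); exists o.
by exists o => x; exact: omin.
Qed.

Lemma omega1_gt x : exists y, x < y.
Proof.
have [b xb] := omega1_countable_bounded (countable1 x).
by exists b; exact: xb.
Qed.

Lemma omega1_sup (f : nat -> T) : (forall n, f n < f n.+1) ->
  exists a, (forall n, f n < a) /\ forall b, b < a -> exists n, b < f n.
Proof.
move=> fS; have [b fb] : exists b, forall x, range f x -> x < b.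
  apply: omega1_countable_bounded.
  exact: sub_countable (card_image_le _ _) (countableP _).
have [|a fa amin] := @omega1_well_founded [set a | forall n, f n < a].
  by exists b => n; apply: fb; exists n.
exists a; split=> // c ca; apply: contrapT => nc.
suff /amin : forall n, f n < c by rewrite leNgt ca.
move=> n; rewrite ltNge; apply/negP => cn; apply: nc; exists n.+1.
exact: le_lt_trans (fS n).
Qed.

Definition unbounded P := forall b, exists2 c, P c & b < c.

Lemma unbounded_infinite P : unbounded P -> infinite_set P.
Proof.
move=> uP /finite_set_countable /omega1_countable_bounded[b Pb].
by have [c /Pb cb bc] := uP b; move: (lt_trans cb bc); rewrite ltxx.
Qed.

(** Alternate between [P] and [Q] infinitely often and take the supremum.  With
    the set of limits for both, this finds limits of limits; with a club and the
    limits, it shows that limits of limits are stationary. *)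
Lemma exists_common_limit P Q b : unbounded P -> unbounded Q ->
  exists a, [/\ b < a, is_limit a, unbounded_in a P & unbounded_in a Q].
Proof.
move=> uP uQ.
have /choice[g gP] x : exists y, (exists2 c, P c & x < c < y) /\
    (exists2 c, Q c & x < c < y).
  have [u Pu xu] := uP x; have [v Qv xv] := uQ x.
  have [y uvy] := omega1_gt (Order.max u v).
  move: uvy; rewrite gt_max => /andP[uy vy].
  by exists y; split; [exists u; rewrite ?xu|exists v; rewrite ?xv].
have gx x : x < g x.
  by have [[c _ /andP[xc cg]] _] := gP x; exact: lt_trans cg.
have [a [fa acof]] := @omega1_sup (fun n => iter n g b) (fun n => gx _).
have ua R : (forall x, exists2 c, R c & x < c < g x) -> unbounded_in a R.
  move=> Rg x /acof[n xn]; have [c Rc /andP[nc cn]] := Rg (iter n g b).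
  by exists c => //; rewrite (lt_trans xn nc) (lt_trans cn (fa n.+1)).
exists a; split.
- exact: fa 0.
- split; first by exists b; exact: fa 0.
  move=> x /(ua P (fun x => (gP x).1))[c _ xca]; by exists c.
- by apply: ua => x; have [] := gP x.
- by apply: ua => x; have [] := gP x.
Qed.

Lemma unbounded_limit : unbounded (@is_limit _ T).
Proof.
have uT : unbounded setT by move=> b; have [c bc] := omega1_gt b; exists c.
by move=> b; have [a [ba la _ _]] := exists_common_limit b uT uT; exists a.
Qed.

Definition limit_of_limits : set T :=
  [set a | is_limit a /\ unbounded_in a is_limit].

Lemma stationary_limit_of_limits : stationary limit_of_limits.
Proof.
move=> C [uC cC].
have [o _] := omega1_bottom.
have [a [_ la aC al]] := exists_common_limit o uC unbounded_limit.
by exists a; split; [split|exact: cC].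
Qed.

(** * The parent function *)

Lemma exists_succ : exists s : T -> T,
  forall x, x < s x /\ forall y, x < y -> s x <= y.
Proof.
have /choice[s sP] x : exists y, x < y /\ forall z, x < z -> y <= z.
  have [|y xy ymin] := @omega1_well_founded [set y | x < y].
    exact: omega1_gt.
  by exists y.
by exists s.
Qed.

(** Writing an ordinal as [l + n] with [l] a limit is unique, so the injections
    [e l] let each limit [l] provide a child to all smaller ordinals at once: [l
    + e l g] is a child of [g].  Hence every [g] has a child between any limit
    above it and the next one. *)
Lemma exists_parent : exists p : T -> T, (forall x, p x <= x) /\
  forall a g b, limit_of_limits a -> g < a -> b < a ->
    exists2 x, b < x < a & p x = g.
Proof.
have [s sP] := exists_succ.
have ltS x : x < s x by have [] := sP x.
have leS x y : x < y -> s x <= y by have [_] := sP x; apply.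
have injS x y : s x = s y -> x = y.
  move=> sxy; case: (ltgtP x y) => // /leS.
    by rewrite sxy leNgt ltS.
  by rewrite -sxy leNgt ltS.
have nlimS x : ~ is_limit (s x).
  move=> [_ /(_ x (ltS x))[c /andP[xc cs]]].
  by move: cs; rewrite ltNge leS.
have leI n l : l <= iter n s l.
  by elim: n => //= n ln; exact: le_trans ln (ltW (ltS _)).
have ltI a l n : is_limit a -> l < a -> iter n s l < a.
  move=> [_ la] ltla; elim: n => //= n /la[c /andP[nc ca]].
  exact: le_lt_trans (leS _ _ nc) ca.
have injI l m i j : is_limit l -> is_limit m ->
    iter i s l = iter j s m -> l = m /\ i = j.
  move=> ll lm; elim: i j => [|i IH] [|j] //=.
  - by move=> ls; move: ll; rewrite ls => /nlimS.
  - by move=> sm; move: lm; rewrite -sm => /nlimS.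
  - by move=> /injS/IH[-> ->].
have /choice[e einj] l :
    exists f : T -> nat, {in [set y | y < l] &, injective f}.
  exact/countable_injP/omega1_countable_below.
pose child g x := exists l, [/\ is_limit l, g < l & x = iter (e l g) s l].
(* The default value [x] makes an ordinal that is nobody's child its own parent,
   that is, a root. *)
exists (fun x => xget x [set g | child g x]); split.
  move=> x; case: xgetP => // g _ [l [_ gl ->]].
  exact: le_trans (ltW gl) (leI _ _).
move=> a g b [la al] ga ba.
have [l ll /andP[]] : exists2 l, is_limit l & Order.max g b < l < a.
  by apply: al; rewrite gt_max ga.
rewrite gt_max => /andP[gl bl] lta.
exists (iter (e l g) s l).
  by rewrite ltI // andbT (lt_le_trans bl (leI _ _)).
apply: xget_unique; first by exists l.
move=> h [m [lm hm]] /(injI _ _ _ _ ll lm)[lm' egh].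
rewrite -{}lm' in hm egh; apply/esym/(einj l) => //; exact/mem_set.
Qed.

Lemma limit_enumeration a : is_limit a ->
  exists e : nat -> T,
    (forall n, e n < a) /\ forall b, b < a -> exists n, e n = b.
Proof.
move=> [[o oa] _]; have /countable_injP[f finj] := omega1_countable_below a.
pose P n := [set b | b < a /\ f b = n].
exists (fun n => xget o (P n)); split=> [n|b ba].
  by case: xgetP => // b _ [].
exists (f b); apply: xget_unique => // c [ca fcb].
by apply: finj => //; exact/mem_set.
Qed.

(** Start at the least ordinal and at stage [n] climb to a child that passes the
    [n]-th element of an enumeration of the ordinals below [a]. *)
Lemma exists_branch (p : T -> T) o a : is_limit a ->
  (forall x, o <= x) ->
  (forall g b, g < a -> b < a -> exists2 x, b < x < a & p x = g) ->
  exists f : nat -> T, [/\ f 0 = o, forall n, p (f n.+1) = f n &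
    ladder_at a (range f)].
Proof.
move=> la omin pa.
have oa : o < a by have [[b ba] _] := la; exact: le_lt_trans ba.
have [e [ea eP]] := limit_enumeration la.
have /choice[g gP] (nx : nat * T) : exists y, nx.2 < a ->
    [/\ nx.2 < y, e nx.1 < y, y < a & p y = nx.2].
  case: nx => n x /=; have [xa|nxa] := pselect (x < a); last by exists o.
  have [|y /andP[]] := pa x (Order.max x (e n)) xa.
    by rewrite gt_max xa ea.
  by rewrite gt_max => /andP[xy ey] ya pyx; exists y.
pose f := fix f n := if n is k.+1 then g (k, f k) else o.
have fa n : f n < a.
  by elim: n => //= n /(gP (n, f n))[].
have fP n : [/\ f n < f n.+1, e n < f n.+1 & p (f n.+1) = f n].
  by have [] := gP (n, f n) (fa n).
exists f; split=> // [n|]; first by have [] := fP n.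
exists f; split=> //.
- by apply: homo_ltn => [y x z|n]; [exact: lt_trans|have [] := fP n].
- by move=> b /eP[n <-]; exists n.+1; have [] := fP n.
Qed.

End omega1.

Theorem corollary4p16 :
  exists (L : set omega1) (c : omega1 -> set omega1),
    ladder_system L c /\
    mrowka_space (K_space (ladder_family L c)) /\
    exists op : K_space (ladder_family L c) -> K_space (ladder_family L c) ->
                K_space (ladder_family L c),
      join_semilattice_op op /\
      continuous (fun p : K_space (ladder_family L c) *
                          K_space (ladder_family L c) => op p.1 p.2).
Proof.
have [p [p_le p_onto]] := exists_parent.
have [o omin] := omega1_bottom.
have /choice[f fP] a : exists f : nat -> omega1, limit_of_limits a ->
    [/\ f 0 = o, forall n, p (f n.+1) = f n & ladder_at a (range f)].
  have [La|nLa] := pselect (limit_of_limits a); last by exists (fun=> o).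
  have [f fP] := exists_branch La.1 omin (fun g b => p_onto a g b La).
  by exists f.
exists limit_of_limits, (fun a => range (f a)).
have ls : ladder_system limit_of_limits (fun a => range (f a)).
  split; first exact: stationary_limit_of_limits.
  by move=> a /fP[].
have ad := ladder_family_almost_disjoint ls.
split=> //; split.
  apply: K_space_mrowka => //; apply: ladder_family_infinite ls _.
  apply: unbounded_infinite => b.
  have [a [ba la al _]] :=
    exists_common_limit b unbounded_limit unbounded_limit.
  by exists a => //; split.
apply: (K_space_semilattice (tle := ancestor p)) => //.
  exact: ancestor_tree p_le omega1_well_founded.
move=> _ [a [/fP[f0 fS _] _] <-]; apply: branch_initial_chain => //.
by apply/le_anti; rewrite p_le f0 omin.
Qed.
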